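(* Let $n\ge 1$ be an integer, $[n]=\{0,\dots,n-1\}$, let $(X_i)_{i\in[n]}$ be nontrivial strictly convex Banach spaces, and let $Z=\bigoplus_{i\in[n]}X_i$ with the norm $\|z\|=\max_{i\in[n]}\|\pi_i z\|$, where $\pi_i\colon Z\to X_i$ is the projection onto the $i$-th component. Let $B_Z$ be the closed unit ball of $Z$ and $S_i$ the unit sphere of $X_i$. Let $g\colon B_Z\to B_Z$ be a non-contractive function. Then there are a permutation $\sigma\colon[n]\to[n]$ and a family of non-contractive functions $g_i\colon S_i\to S_{\sigma(i)}$, $i\in[n]$, such that for all $x\in B_Z$ and all $i\in[n]$, $$\pi_i x\in S_i\;\Rightarrow\;\pi_{\sigma(i)}\,g(x)=g_i(\pi_i x).$$
   Context: A Banach space is strictly convex if its unit sphere contains no line segment with distinct endpoints; nontrivial means different from $\{0\}$. A map $h$ between metric spaces is non-contractive if $d(x,y)\le d(h(x),h(y))$ for all $x,y$ (no continuity or surjectivity is assumed). *)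

(* Defs.v *)
From HB Require Import structures.
From mathcomp Require Import all_boot all_order all_algebra.
From mathcomp Require Import fingroup perm.
From mathcomp Require Import all_classical all_reals all_analysis.

Set Implicit Arguments.
Unset Strict Implicit.
Unset Printing Implicit Defensive.

Import Order.TTheory GRing.Theory Num.Theory.
Import numFieldNormedType.Exports.
Local Open Scope classical_set_scope.
Local Open Scope ring_scope.

Definition unit_sphere {R : realType} (V : normedModType R) : set V :=
  [set x | `|x| = 1].
Arguments unit_sphere {R} V _.

Definition unit_ball {R : realType} (V : normedModType R) : set V :=
  [set x | `|x| <= 1].
Arguments unit_ball {R} V _.

Definition line_segment {R : realType} {V : normedModType R} (x y : V) : set V :=
  [set (1 - t) *: x + t *: y | t in `[0, 1]%classic].

Definition strictly_convex {R : realType} (V : normedModType R) : Prop :=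
  forall x y : V, x <> y -> ~ (line_segment x y `<=` unit_sphere V).

Definition nontrivial {R : realType} (V : normedModType R) : Prop :=
  [set: V] <> [set 0].

Definition noncontractive_on {R : realType} {V W : normedModType R}
    (A : set V) (h : V -> W) : Prop :=
  forall x y, A x -> A y -> `|x - y| <= `|h x - h y|.

(* A type alias of its own, to keep clear of the canonical structures on
   function types. The projection onto the i-th component is application to i. *)
Definition max_sum {R : realType} {I : finType} (X : I -> normedModType R)
  : Type := forall i, X i.

Section MaxSum.
Context {R : realType} {I : finType} (X : I -> normedModType R).
Local Notation Z := (max_sum X).

HB.instance Definition _ := gen_eqMixin Z.
HB.instance Definition _ := gen_choiceMixin Z.

Fact max_sum_ext (x y : Z) : (forall i, x i = y i) -> x = y.
Proof. exact: functional_extensionality_dep. Qed.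

Definition max_sum_zero : Z := fun i => 0.
Definition max_sum_opp (x : Z) : Z := fun i => - x i.
Definition max_sum_add (x y : Z) : Z := fun i => x i + y i.
Definition max_sum_scale (a : R) (x : Z) : Z := fun i => a *: x i.

Fact max_sum_addA : associative max_sum_add.
Proof. by move=> x y z; apply: max_sum_ext => i; exact: addrA. Qed.
Fact max_sum_addC : commutative max_sum_add.
Proof. by move=> x y; apply: max_sum_ext => i; exact: addrC. Qed.
Fact max_sum_add0 : left_id max_sum_zero max_sum_add.
Proof. by move=> x; apply: max_sum_ext => i; exact: add0r. Qed.
Fact max_sum_addN : left_inverse max_sum_zero max_sum_opp max_sum_add.
Proof. by move=> x; apply: max_sum_ext => i; exact: addNr. Qed.

HB.instance Definition _ := GRing.isZmodule.Build Z
  max_sum_addA max_sum_addC max_sum_add0 max_sum_addN.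

Fact max_sum_scaleA a b x :
  max_sum_scale a (max_sum_scale b x) = max_sum_scale (a * b) x.
Proof. by apply: max_sum_ext => i; exact: (scalerA a b (x i)). Qed.
Fact max_sum_scale1 : left_id 1 max_sum_scale.
Proof. by move=> x; apply: max_sum_ext => i; exact: scale1r. Qed.
Fact max_sum_scaleDr : right_distributive max_sum_scale +%R.
Proof. move=> a x y; apply: max_sum_ext => i; exact: (scalerDr a (x i) (y i)). Qed.
Fact max_sum_scaleDl x : {morph max_sum_scale^~ x : a b / a + b}.
Proof. move=> a b; apply: max_sum_ext => i; exact: (scalerDl (x i) a b). Qed.

HB.instance Definition _ := GRing.Zmodule_isLmodule.Build R Z
  max_sum_scaleA max_sum_scale1 max_sum_scaleDr max_sum_scaleDl.

(* Starting the maximum at 0 is harmless, norms being nonnegative. *)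
Definition max_sum_norm (x : Z) : R := \big[Num.max/0]_(i : I) `|x i|.

Fact max_sum_ler_normD x y :
  max_sum_norm (x + y) <= max_sum_norm x + max_sum_norm y.
Proof.
apply: bigmax_le => [|i _].
  by apply: addr_ge0; apply: bigmax_ge_id.
apply: (le_trans (ler_normD (x i) (y i))).
apply: lerD; first exact: (le_bigmax _ (fun j => `|x j|)).
exact: (le_bigmax _ (fun j => `|y j|)).
Qed.

Fact max_sum_normrZ a x : max_sum_norm (a *: x) = `|a| * max_sum_norm x.
Proof.
rewrite /max_sum_norm (big_endo (fun r => `|a| * r)) ?mulr0 //.
- by apply: eq_bigr => i _; exact: normrZ.
- by move=> u v; rewrite maxr_pMr.
Qed.

Fact max_sum_normr0_eq0 x : max_sum_norm x = 0 -> x = 0.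
Proof.
move=> x0; apply: max_sum_ext => i; apply/eqP.
by rewrite -normr_le0 -x0 (le_bigmax _ (fun j => `|x j|)).
Qed.

HB.instance Definition _ := Lmodule_isNormed.Build R Z
  max_sum_ler_normD max_sum_normrZ max_sum_normr0_eq0.

End MaxSum.

(* Main.v *)
Require Import Defs.
From HB Require Import structures.
From mathcomp Require Import all_boot all_order all_algebra.
From mathcomp Require Import fingroup perm.
From mathcomp Require Import all_classical all_reals all_analysis.
From mathcomp Require Import lra.

Set Implicit Arguments.
Unset Strict Implicit.
Unset Printing Implicit Defensive.

Import Order.TTheory GRing.Theory Num.Theory.
Import numFieldNormedType.Exports.
Local Open Scope ring_scope.

(** Only two consequences of the hypothesis on [g] are used to find the permutation:
[g] is injective, and it preserves the distance 2. In a strictly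
convex unit ball two points are at distance 2 only if they are opposite unit
vectors, so two points of the ball of a max-sum are at distance 2 exactly
when they have opposite unit vectors in some coordinate; [g] preserves this relation.

Call a point all of whose coordinates are unit vectors a corner. Changing the
signs of the coordinates of a corner [x] in all ways gives [2 ^ n] corners,
pairwise opposite in some coordinate, and so are their images. Such families
are rigid. Pick at random, independently in each coordinate, one vector of each
pair of opposite unit vectors; two points that are opposite somewhere are never
both picked. So the images define [2 ^ n] disjoint events, each of probability
at least [2 ^ - n]: hence all images are corners, and the events form a
partition. The measure theory is avoided by conditioning on the event of a
single point [p]: the conditional probability that [z] is picked is a product
of factors [share], each 0, 1/2 or 1, and the two facts needed are
[sum_share_le1] (disjoint events) and [sum_share_tight] (partition).

The partition alone leaves room for twisted families, even for [n = 2]. They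
are excluded by one more point: the midpoint [m] of [x] and of [x'], which is
[x] with its [i]-th sign changed. It is opposite somewhere to each of the
[2 ^ n] corners but [x] and [x'], so the event of [g m] is shared between those
of [g x] and [g x'] alone; as [g m] is neither of these points, each gets
exactly one half, which forces [g x] and [g x'] to differ in exactly one
coordinate ([corner_edge]). So [g] maps the edges of the cube of [x] to edges,
and therefore induces an injection [edge_dir x] of the coordinates
([cube_image]). Comparing an arbitrary point [p] with [p i = x i] to the
opposite facet of that cube pins down one coordinate of [g p]
([face_image]); from this [edge_dir x] does not depend on [x]
([edge_dir_const]), and it is the permutation looked for. *)

(** * Random choice of one vector in each pair of opposite unit vectors *)

Section Shares.
Context {R : realType}.

Definition opposite {V : normedModType R} (a b : V) : Prop :=
  `|a| = 1 /\ b = - a.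

Lemma unit_neq_opp (V : normedModType R) (a : V) : `|a| = 1 -> (a == - a) = false.
Proof.
move=> a1; apply/negP => /eqP aNa.
have /eqP : 2 *: a = 0 by rewrite scaler_nat mulr2n {2}aNa subrr.
rewrite scaler_eq0 pnatr_eq0 /= => /eqP a0.
by move/eqP: a1; rewrite a0 normr0 eq_sym oner_eq0.
Qed.

(** A fixed choice of one vector in each pair [{a, - a}]: the predicate given to
[choose] is the same for [a] and [- a], so the chosen vector is the same too. *)
Definition half_sphere {V : normedModType R} (a : V) : bool :=
  choose [pred v | (v == a) || (v == - a)] a == a.

Lemma half_sphereN (V : normedModType R) (a : V) :
  `|a| = 1 -> half_sphere (- a) = ~~ half_sphere a.
Proof.
move=> a1; rewrite /half_sphere.
have -> : choose [pred v | (v == - a) || (v == - - a)] (- a) =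
          choose [pred v | (v == a) || (v == - a)] a.
  rewrite (@choose_id _ _ (- a) a) /=; last 2 first.
  - by rewrite eqxx.
  - by rewrite opprK eqxx orbT.
  by apply: eq_choose => v /=; rewrite opprK orbC.
have /= := @chooseP _ [pred v | (v == a) || (v == - a)] a.
rewrite eqxx => /(_ isT).
have aN := unit_neq_opp a1.
by case/orP => /eqP ->; rewrite eqxx ?aN // eq_sym aN.
Qed.

(** The conditional probability that [a] is picked when [p] is. Vectors of norm
different from 1 take no part in the random choice, and impose no condition. *)
Definition share {V : normedModType R} (a p : V) : R :=
  if `|a| != 1 then 1 else
  if p == a then 1 else if p == - a then 0 else 2^-1.

(** Two deterministic choices compatible with [p], opposite to each other on the
unit vectors other than [p] and [- p]. *)
Definition selected {V : normedModType R} (p : V) (b : bool) (a : V) : bool :=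
  [|| `|a| != 1, p == a | (p != - a) && (half_sphere a == b)].

(** This is what makes an induction on the coordinates possible: in one coordinate,
the random choice can be replaced by two equally likely ones. *)
Lemma share_selected (V : normedModType R) (a p : V) :
  share a p = 2^-1 * ((selected p true a)%:R + (selected p false a)%:R).
Proof.
rewrite /share /selected; case: (eqVneq `|a| 1) => a1 /=; last by lra.
case: (eqVneq p a) => [->|pa] /=; first by lra.
case: (eqVneq p (- a)) => _ /=; first by lra.
by case: half_sphere => /=; lra.
Qed.

Lemma selected_opposite (V : normedModType R) (p : V) b (a a' : V) :
  opposite a a' -> selected p b a -> selected p b a' -> False.
Proof.
case=> a1 ->; rewrite /selected normrN a1 eqxx /= opprK half_sphereN //.
case: (eqVneq p a) => [->|pa] /=; first by rewrite unit_neq_opp.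
case: (eqVneq p (- a)) => //= _.
by case: half_sphere; case: b.
Qed.

Lemma share_ge0 (V : normedModType R) (a p : V) : 0 <= share a p.
Proof. by rewrite /share; do 3?[case: ifP => _]; lra. Qed.

Lemma share_le1 (V : normedModType R) (a p : V) : share a p <= 1.
Proof. by rewrite /share; do 3?[case: ifP => _]; lra. Qed.

Lemma share_opposite (V : normedModType R) (a p : V) : opposite a p -> share a p = 0.
Proof.
by case=> a1 ->; rewrite /share a1 !eqxx /= eq_sym unit_neq_opp.
Qed.

Lemma share_eq1 (V : normedModType R) (a p : V) :
  `|a| = 1 -> share a p = 1 -> p = a.
Proof.
move=> a1; rewrite /share a1 eqxx /=.
by case: eqP => // _; case: ifP => _ ?; exfalso; lra.
Qed.

Lemma share_neq1 (V : normedModType R) (a p : V) :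
  share a p != 1 -> share a p <= 2^-1.
Proof. by rewrite /share; do 3?[case: ifP => _]; rewrite ?eqxx //; lra. Qed.

(** The law of total probability for a choice between [p] and [- p]. The value 2
for vectors off the sphere is what detects them in [sum_share_tight]. *)
Lemma share_addN (V : normedModType R) (a p : V) :
  share a (- p) + share a p = if `|a| == 1 then 1 else 2.
Proof.
rewrite /share; case: (eqVneq `|a| 1) => a1 /=; last by lra.
rewrite eqr_opp eqr_oppLR; case: (eqVneq p a) => [->|_].
  by rewrite unit_neq_opp // add0r.
by case: (eqVneq p (- a)) => _; lra.
Qed.

Context {I : finType} {Y : I -> normedModType R}.
Implicit Types (p z : max_sum Y) (A : {set I}).

(** Points that are pairwise opposite in a coordinate of [A] are picked in disjoint
events, so their conditional probabilities add up to at most 1. Fix one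
coordinate [j] of [A]. Each of the two choices compatible with [p j] selects a
subfamily without opposite vectors in coordinate [j], to which the induction
hypothesis on [A :\ j] applies; the sum is the mean of the two bounds. *)
Lemma sum_share_le1 (T : finType) (w : T -> max_sum Y) p A (P : {set T}) :
  (forall s t, s \in P -> t \in P -> s != t ->
     exists2 j, j \in A & opposite (w s j) (w t j)) ->
  \sum_(t in P) \prod_(j in A) share (w t j) (p j) <= 1.
Proof.
move: {2}#|A| (erefl #|A|) => k; elim: k A P => [|k IHk] A P.
  move/eqP; rewrite cards_eq0 => /eqP -> wP.
  have P1 : (#|P| <= 1)%N.
    apply/card_le1_eqP => s t sP tP; apply/eqP; apply/negPn/negP => st.
    by have [j] := wP _ _ tP sP st; rewrite inE.
  under eq_bigr do rewrite big_set0.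
  by rewrite sumr_const -mulr_natl mulr1 lern1.
move=> Ak wP.
have /card_gt0P[j jA] : (0 < #|A|)%N by rewrite Ak.
pose H b := [set t in P | selected (p j) b (w t j)].
pose a t := \prod_(i in A :\ j) share (w t i) (p i).
have IH b : \sum_(t in H b) a t <= 1.
  apply: IHk => [|s t]; first by move: Ak; rewrite (cardsD1 j A) jA => -[].
  rewrite !inE => /andP[sP ss] /andP[tP ts] st.
  have [i iA opp] := wP _ _ sP tP st.
  exists i => //; rewrite !inE iA andbT; apply/eqP => ij.
  by move: opp; rewrite ij => opp; exact: (selected_opposite opp ss ts).
have -> : \sum_(t in P) \prod_(i in A) share (w t i) (p i) =
    2^-1 * (\sum_(t in H true) a t + \sum_(t in H false) a t).
  rewrite !(big_mkcond (fun t => t \in _)) /= -big_split /= mulr_sumr.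
  apply: eq_bigr => t _; rewrite !inE; case: (t \in P) => /=; last by rewrite addr0 mulr0.
  rewrite (big_setD1 j) //= -/(a t) share_selected.
  by case: selected; case: selected => /=; lra.
have := IH true; have := IH false; lra.
Qed.

(** All factors are 0, 1/2 or 1, and one of them is not 1 since [p] differs from
[z]; to reach 1/2 that factor must be 1/2 and all the others 1. *)
Lemma share_prod_half p z : (forall i, `|z i| = 1) -> p <> z ->
  \prod_i share (z i) (p i) <= 2^-1 /\
  (2^-1 <= \prod_i share (z i) (p i) ->
   exists j, p j <> - z j /\ forall k, k != j -> p k = z k).
Proof.
move=> z1 pz.
have rest01 (P : pred I) : 0 <= \prod_(i | P i) share (z i) (p i) <= 1.
  apply: (big_ind (fun r : R => 0 <= r <= 1)); first by rewrite ler01 lexx.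
    by move=> a b /andP[a0 a1] /andP[b0 b1]; rewrite mulr_ge0 ?mulr_ile1.
  by move=> i _; rewrite share_ge0 share_le1.
have [j sj] : exists j, share (z j) (p j) != 1.
  apply: contrapT => nj; apply/pz/max_sum_ext => k; apply: share_eq1 => //.
  by apply/eqP/negPn/negP => sk; apply: nj; exists k.
have sj2 := share_neq1 sj; have sj0 := share_ge0 (z j) (p j).
rewrite (bigD1 j) //=; split.
  by have /andP[r0 r1] := rest01 (fun i => i != j); nra.
move=> big; exists j; split=> [pj|k kj].
  have s0 : share (z j) (p j) = 0 by apply: share_opposite; split.
  by move: big; rewrite s0 mul0r leNgt invr_gt0 ltr0n.
apply: share_eq1 => //; apply/eqP/negPn/negP => /share_neq1 sk2.
move: big; rewrite (bigD1 k) //=.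
have /andP[r0 r1] := rest01 (fun i => (i != j) && (i != k)).
have sk0 := share_ge0 (z k) (p k).
set s := \prod_(i | _) _ in r0 r1 *.
have : share (z k) (p k) * s <= 2^-1 by nra.
move=> sks /(fun e => le_trans e (ler_pM sj0 (mulr_ge0 sk0 r0) sj2 sks)).
by clear pz => quarter; lra.
Qed.

Definition flip A z : max_sum Y := fun i => if i \in A then - z i else z i.

(** Averaged over all sign changes of [p], the conditional probability of a point
with [k] coordinates off the sphere is [2 ^ k / 2 ^ n]. There are [2 ^ n] points,
so the averages add up to at least 1, while each sum is at most 1: equality
holds throughout. *)
Lemma sum_share_tight (w : {set I} -> max_sum Y) :
  (forall A B, A != B -> exists j, opposite (w A j) (w B j)) ->
  (forall A i, `|w A i| = 1) /\
  (forall p, \sum_A \prod_i share (w A i) (p i) = 1).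
Proof.
move=> wopp.
have le1 p : \sum_A \prod_i share (w A i) (p i) <= 1.
  have -> : \sum_A \prod_i share (w A i) (p i) =
      \sum_(A in [set: {set I}]) \prod_(i in [set: I]) share (w A i) (p i).
    apply: eq_big => [A|A _]; first by rewrite inE.
    by apply: eq_bigl => i; rewrite inE.
  by apply: sum_share_le1 => A B _ _ /wopp[j jo]; exists j; rewrite ?inE.
have avg p : \sum_B \sum_A \prod_i share (w A i) (flip B p i) =
    \sum_A \prod_i (if `|w A i| == 1 then 1 else 2).
  rewrite exchange_big /=; apply: eq_bigr => A _.
  transitivity (\prod_i (share (w A i) (- p i) + share (w A i) (p i))); last first.
    by apply: eq_bigr => i _; rewrite share_addN.
  rewrite bigA_distr; apply: eq_bigr => B _; apply: eq_bigr => i _.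
  by rewrite /flip; case: ifP.
have ge1 (P : pred I) A : 1 <= \prod_(i | P i) (if `|w A i| == 1 then 1 else 2) :> R.
  apply: (big_ind (fun r : R => 1 <= r)) => [//|x y x1 y1|i _].
    by rewrite -[1]mulr1 ler_pM.
  by case: ifP => _; rewrite ?ler1n.
have gap1_ge p B : true -> 0 <= 1 - \sum_A \prod_i share (w A i) (flip B p i).
  by rewrite subr_ge0.
have gap2_ge A : true -> 0 <= \prod_i (if `|w A i| == 1 then 1 else 2) - 1 :> R.
  by rewrite subr_ge0 ge1.
have gaps p : \sum_B (1 - \sum_A \prod_i share (w A i) (flip B p i)) = 0 /\
    \sum_A (\prod_i (if `|w A i| == 1 then 1 else 2) - 1) = 0 :> R.
  have /eqP : \sum_B (1 - \sum_A \prod_i share (w A i) (flip B p i)) +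
      \sum_A (\prod_i (if `|w A i| == 1 then 1 else 2) - 1) = 0.
    by rewrite !sumrB avg; lra.
  rewrite (paddr_eq0 (sumr_ge0 _ (gap1_ge p)) (sumr_ge0 _ gap2_ge)).
  by move=> /andP[/eqP -> /eqP ->].
split=> [A i|p].
  have [_ gap2] := gaps 0.
  have /(_ A isT) := psumr_eq0P gap2_ge gap2.
  rewrite (bigD1 i) //=; case: eqP => // _.
  have := ge1 (fun k => k != i) A; lra.
have [gap1 _] := gaps p.
have /(_ finset.set0 isT)/eqP := psumr_eq0P (gap1_ge p) gap1.
rewrite subr_eq0 => /eqP tight; rewrite [RHS]tight.
apply: eq_bigr => A _; apply: eq_bigr => i _.
by rewrite /flip inE.
Qed.

End Shares.

(** * The image of the cube of sign changes of a corner *)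

Section Corners.
Context {R : realType} {I : finType} {X Y : I -> normedModType R}.
Implicit Types (x y p z : max_sum X) (A : {set I}).

Lemma norm_coord (Z : I -> normedModType R) (z : max_sum Z) i : `|z i| <= `|z|.
Proof. exact: (le_bigmax _ (fun j => `|z j|)). Qed.

Lemma unit_ballP (Z : I -> normedModType R) (z : max_sum Z) :
  unit_ball (max_sum Z) z <-> forall i, `|z i| <= 1.
Proof.
split=> [z1 i|z1]; first exact: le_trans (norm_coord z i) z1.
by apply: bigmax_le => // i _; exact: z1.
Qed.

(** The whole segment from [a] to [- b] lies on the sphere: the point with parameter
[t] and the one with parameter [1 - t] add up to [a - b], of norm at least 2. *)
Lemma strictly_convex_opposite (V : normedModType R) (a b : V) :
  strictly_convex V -> `|a| <= 1 -> `|b| <= 1 -> 2 <= `|a - b| -> opposite a b.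
Proof.
move=> cV a1 b1 ab.
have := ler_normB a b => tri.
split; first by lra.
apply/eqP; rewrite -eqr_oppLR; apply/eqP; apply: contrapT => nab.
apply: (cV a (- b)) => [e|]; first by exact/nab/esym.
move=> _ [t t01 <-]; move: t01; rewrite /= in_itv /= => /andP[t0 t1].
rewrite /unit_sphere /=; apply/eqP; rewrite eq_le; apply/andP; split.
  apply: le_trans (ler_normD _ _) _; rewrite !normrZ normrN.
  rewrite !ger0_norm ?subr_ge0 //; nra.
have e : a - b = ((1 - t) *: a + t *: (- b)) + (t *: a + (1 - t) *: (- b)).
  rewrite addrACA -!scalerDl subrK scale1r.
  by rewrite [t + _]addrC subrK scale1r.
have : `|t *: a + (1 - t) *: (- b)| <= 1.
  apply: le_trans (ler_normD _ _) _; rewrite !normrZ normrN.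
  rewrite !ger0_norm ?subr_ge0 //; nra.
have := ler_normD ((1 - t) *: a + t *: (- b)) (t *: a + (1 - t) *: (- b)).
rewrite -e; lra.
Qed.

Definition corner x := forall i, `|x i| = 1.

Lemma corner_ball x : corner x -> unit_ball (max_sum X) x.
Proof. by move=> xc; apply/unit_ballP => i; rewrite xc. Qed.

Lemma corner_flip A x : corner x -> corner (flip A x).
Proof. by move=> xc i; rewrite /flip; case: ifP; rewrite ?normrN. Qed.

Lemma flip_setU1 (Z : I -> normedModType R) (z : max_sum Z) i A :
  i \notin A -> flip (i |: A) z = flip [set i]%SET (flip A z).
Proof.
move=> iA; apply: max_sum_ext => k; rewrite /flip !inE.
by case: eqVneq => [->|_] //=; rewrite (negbTE iA).
Qed.

Lemma flip0 (Z : I -> normedModType R) (z : max_sum Z) :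
  flip finset.set0 z = z.
Proof. by apply: max_sum_ext => i; rewrite /flip inE. Qed.

Lemma flip1K (Z : I -> normedModType R) (z : max_sum Z) i :
  flip [set i]%SET (flip [set i]%SET z) = z.
Proof.
by apply: max_sum_ext => k; rewrite /flip inE; case: eqP; rewrite ?opprK.
Qed.

Context (Yconvex : forall i, strictly_convex (Y i)).
Context (g : max_sum X -> max_sum Y).
Context (g_ball :
  forall x, unit_ball (max_sum X) x -> unit_ball (max_sum Y) (g x)).
Context (g_expand : noncontractive_on (unit_ball (max_sum X)) g).

Lemma opposite_image x y i :
  unit_ball (max_sum X) x -> unit_ball (max_sum X) y ->
  opposite (x i) (y i) -> exists j, opposite (g x j) (g y j).
Proof.
move=> xB yB [xi yi]; apply: contrapT => nopp.
have : 2 <= `|g x - g y|.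
  apply: le_trans (g_expand xB yB).
  apply: le_trans (norm_coord (x - y) i).
  have -> : (x - y) i = 2 *: x i.
    by rewrite [LHS](_ : _ = x i - y i) // yi opprK scaler_nat mulr2n.
  by rewrite normrZ xi mulr1 ger0_norm.
apply/negP; rewrite -ltNge; apply: bigmax_lt => [|j _]; first by [].
rewrite ltNge; apply/negP => far; apply: nopp; exists j.
have /unit_ballP gxB := g_ball xB.
have /unit_ballP gyB := g_ball yB.
exact: (@strictly_convex_opposite (Y j)).
Qed.

Lemma image_inj x y :
  unit_ball (max_sum X) x -> unit_ball (max_sum X) y -> g x = g y -> x = y.
Proof.
move=> xB yB gxy; have := g_expand xB yB.
by rewrite gxy subrr normr0 normr_le0 subr_eq0 => /eqP.
Qed.

Lemma flips_opposite x A B : corner x -> A != B ->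
  exists j, opposite (g (flip A x) j) (g (flip B x) j).
Proof.
move=> xc AB; have [i iAB] : exists i, (i \in A) != (i \in B).
  apply/existsP; apply: contraNT AB; rewrite negb_exists => /forallP AB.
  by apply/eqP/setP => i; have := AB i; rewrite negbK => /eqP.
apply: (@opposite_image _ _ i); try exact/corner_ball/corner_flip.
split; first exact: corner_flip.
by move: iAB; rewrite /flip; do 2!case: ifP => _; rewrite ?eqxx ?opprK.
Qed.

(** The [2 ^ n] images of the sign changes of [x] fill the probability space, which
they could not do with a coordinate off the sphere. *)
Lemma corner_image x : corner x -> forall j, `|g x j| = 1.
Proof.
move=> xc j; have [full _] := sum_share_tight (fun A B => @flips_opposite x A B xc).
by rewrite -(full finset.set0 j) flip0.
Qed.

(** The midpoint [m] of an edge of the cube is opposite somewhere to every corner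
but the two ends of the edge, so the images of these two ends share the event of
[g m], one half each. *)
Lemma corner_edge x i : corner x ->
  exists j, g (flip [set i]%SET x) = flip [set j]%SET (g x).
Proof.
move=> xc; set x' := flip _ x.
have x'c : corner x' by exact: corner_flip.
have xB := corner_ball xc; have x'B := corner_ball x'c.
pose m : max_sum X := dfwith x i 0.
have mB : unit_ball (max_sum X) m.
  apply/unit_ballP => k; rewrite /m; case: (eqVneq i k) => [<-|ik].
    by rewrite dfwithin normr0.
  by rewrite dfwithout // xc.
have m_i : m i = 0 by rewrite /m dfwithin.
have neq_m y : corner y -> y <> m.
  by move=> yc ym; have := yc i; rewrite ym m_i normr0 => /esym/eqP; rewrite oner_eq0.
have [_ /(_ (g m)) tight] := sum_share_tight (fun A B => @flips_opposite x A B xc).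
pose S A := \prod_k share (g (flip A x) k) (g m k).
have S0 A : A != finset.set0 -> A != [set i]%SET -> S A = 0.
  move=> A0 Ai.
  have [k kA ki] : exists2 k, k \in A & k != i.
    apply: contrapT => nk.
    have sub : A \subset [set i]%SET.
      apply/fintype.subsetP => k kA; rewrite inE; apply/negPn/negP => ki.
      by apply: nk; exists k.
    by move: sub; rewrite finset.subset1 (negbTE A0) (negbTE Ai).
  have fB : unit_ball (max_sum X) (flip A x) by exact/corner_ball/corner_flip.
  have [|l opp] := @opposite_image _ _ k fB mB.
    split; first exact: corner_flip.
    by rewrite /m dfwithout 1?eq_sym // /flip kA opprK.
  by rewrite /S (bigD1 l) //= share_opposite // mul0r.
(* Only the two ends of the edge contribute to the total probability 1. *)
have S2 : S finset.set0 + S [set i]%SET = 1.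
  rewrite -tight (bigD1 finset.set0) //= (bigD1 [set i]%SET) /=; last first.
    by apply/eqP => /setP/(_ i); rewrite !inE eqxx.
  rewrite [X in _ = _ + (_ + X)]big1 ?addr0 // => A /andP[]; exact: S0.
have half y : corner y -> \prod_k share (g y k) (g m k) <= 2^-1 /\
    (2^-1 <= \prod_k share (g y k) (g m k) ->
     exists j, g m j <> - g y j /\ forall k, k != j -> g m k = g y k).
  move=> yc; apply: share_prod_half; first exact: corner_image.
  by move=> gmy; apply: (neq_m _ yc); apply/image_inj => //; exact: corner_ball.
have Sx : S finset.set0 = \prod_k share (g x k) (g m k) by rewrite /S flip0.
have [le_x tight_x] := half _ xc; have [le_x' tight_x'] := half _ x'c.
have [|j [gmj gmx]] := tight_x; first by move: S2; rewrite Sx /S; lra.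
have [|j' [gmj' gmx']] := tight_x'; first by move: S2; rewrite Sx /S; lra.
(* [g m] agrees with [g x] off [j] and with [g x'] off [j'], and [g x], [g x']
   are opposite at [l]; this is possible only if [j], [j'] and [l] coincide. *)
have [l [gxl gx'l]] : exists l, opposite (g x l) (g x' l).
  by apply: (@opposite_image _ _ i) => //; split; rewrite // /x' /flip inE eqxx.
have lj : l = j.
  apply/eqP/negPn/negP => lj; have := gmx l lj.
  case: (eqVneq l j') => [lj'|/gmx' ->].
    by move=> gml; apply: gmj'; rewrite -lj' gml gx'l opprK.
  by rewrite gx'l => /eqP; rewrite eq_sym unit_neq_opp.
have jj' : j' = j.
  apply/eqP/negPn/negP => jj'; apply: gmj.
  by rewrite -lj -gx'l gmx' // lj eq_sym.
exists j; apply: max_sum_ext => k; rewrite /flip inE.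
by case: eqVneq => [->|kj]; rewrite -?lj // -gmx' ?jj' // gmx.
Qed.

(** * The permutation of the coordinates *)

Lemma flip_single_inj (Z : I -> normedModType R) (z : max_sum Z) j k :
  (forall i, `|z i| = 1) -> flip [set j]%SET z = flip [set k]%SET z -> j = k.
Proof.
move=> z1 /(congr1 (fun y : max_sum Z => y j)); rewrite /flip !inE eqxx.
by case: eqVneq => // _ /eqP; rewrite eq_sym unit_neq_opp.
Qed.

Definition edge_dir x i : I :=
  odflt i [pick j | g (flip [set i]%SET x) == flip [set j]%SET (g x)].

Lemma edge_dirP x i : corner x ->
  g (flip [set i]%SET x) = flip [set edge_dir x i]%SET (g x).
Proof.
move=> /corner_edge - /(_ i)[j gj]; rewrite /edge_dir.
by case: pickP => [k /eqP //|/(_ j)]; rewrite gj eqxx.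
Qed.

Lemma edge_dir_unique x i j : corner x ->
  g (flip [set i]%SET x) = flip [set j]%SET (g x) -> edge_dir x i = j.
Proof.
move=> xc; rewrite edge_dirP // => e; apply: flip_single_inj e.
exact: corner_image.
Qed.

(** Two edges at [x] with the same direction of image would have the same image of
their other end. *)
Lemma edge_dir_inj x : corner x -> injective (edge_dir x).
Proof.
move=> xc i j eij; apply: (@flip_single_inj X x) => //.
by apply: image_inj; rewrite ?edge_dirP ?eij //; exact/corner_ball/corner_flip.
Qed.

(** In the square on [x] spanned by the coordinates [i] and [k], the two paths from
[x] to the opposite vertex are mapped to two paths of length two. Their ends
agree and, by injectivity of [g], the end is not [g x]; so both paths change the
same two coordinates, and parallel edges keep their direction. *)
Lemma edge_dir_flip1 x i : corner x -> edge_dir (flip [set i]%SET x) =1 edge_dir x.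
Proof.
move=> xc k; set y := flip _ x; have yc : corner y by exact: corner_flip.
have gyE : g y = flip [set edge_dir x i]%SET (g x) by exact: edge_dirP.
case: (eqVneq k i) => [->|ki].
  apply: edge_dir_unique => //.
  by rewrite gyE /y !flip1K.
set y' := flip [set k]%SET x; have y'c : corner y' by exact: corner_flip.
have gy'E : g y' = flip [set edge_dir x k]%SET (g x) by exact: edge_dirP.
have comm : flip [set k]%SET y = flip [set i]%SET y'.
  apply: max_sum_ext => l; rewrite /y /y' /flip !inE.
  by case: (l == k); case: (l == i).
set a := edge_dir x i in gyE *; set b := edge_dir x k in gy'E *.
have ab : b != a by apply: contra_neq ki => /edge_dir_inj; exact.
have := edge_dirP k yc; rewrite comm edge_dirP // gyE gy'E.
set c := edge_dir y k; set d := edge_dir y' i.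
have gx1 := corner_image xc b.
move=> /(congr1 (fun z : max_sum Y => z b)); rewrite /flip !inE eqxx (negbTE ab).
case: (eqVneq b c) => // bc; case: (eqVneq b d) => [bd|_] /eqP; last first.
  by rewrite eq_sym unit_neq_opp.
move=> _; exfalso.
have : flip [set i]%SET y' = x.
  apply: image_inj; try exact: corner_ball.
  - exact/corner_ball/corner_flip.
  - by rewrite edge_dirP // -/d -bd gy'E flip1K.
move=> /(congr1 (fun z : max_sum X => z i)); rewrite /y' /flip !inE eqxx.
by rewrite [i == k]eq_sym (negbTE ki) => /eqP; rewrite eq_sym unit_neq_opp.
Qed.

(** Walk from [x] to [flip A x] along the edges of the cube. *)
Lemma cube_image x A : corner x ->
  edge_dir (flip A x) =1 edge_dir x /\
  g (flip A x) = flip (edge_dir x @: A) (g x).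
Proof.
move=> xc; move: {2}#|A| (erefl #|A|) => m; elim: m A => [|m IHm] A.
  by move/eqP; rewrite cards_eq0 => /eqP ->; rewrite imset0 !flip0.
move=> Am; have /card_gt0P[i iA] : (0 < #|A|)%N by rewrite Am.
have [|dirA gA] := IHm (A :\ i).
  by move: Am; rewrite (cardsD1 i A) iA => -[].
have iA' : i \notin A :\ i by rewrite !inE eqxx.
have yc : corner (flip (A :\ i) x) by exact: corner_flip.
rewrite -(finset.setD1K iA) flip_setU1 //; split=> [k|].
  by rewrite edge_dir_flip1 // dirA.
rewrite edge_dirP // dirA gA imsetU1 flip_setU1 //.
by rewrite mem_imset //; exact: edge_dir_inj.
Qed.

(** [p] is opposite to every corner of the facet where the [i]-th sign of [x] is
changed. The images of these corners have the opposite of the vector of [g x] in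
coordinate [edge_dir x i], and all combinations of signs elsewhere; choosing the
signs so that no other coordinate is opposite to that of [g p] leaves only this
one. *)
Lemma face_image x p i : corner x -> unit_ball (max_sum X) p ->
  p i = x i -> g p (edge_dir x i) = g x (edge_dir x i).
Proof.
move=> xc pB pxi; set s := edge_dir x.
pose A := [set k | (k == i) || (g x (s k) == - g p (s k))]%SET.
have [_ gA] := cube_image A xc.
have fc : corner (flip A x) by exact: corner_flip.
have [j [gfj gpj]] : exists j, opposite (g (flip A x) j) (g p j).
  apply: (@opposite_image _ _ i) => //; first exact: corner_ball.
  by split; [exact: fc | rewrite pxi /flip inE eqxx opprK].
have [t _ tK] := injF_bij (edge_dir_inj xc).
move: gpj; rewrite gA -(tK j) -/s /flip mem_imset; last exact: edge_dir_inj.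
rewrite inE; case: (eqVneq (t j) i) => [-> |_] /=; first by rewrite opprK.
case: eqP => [e|ne] gp; last by case: ne; rewrite gp opprK.
have := corner_image xc (s (t j)).
by move: gp; rewrite opprK => gp; move/eqP: e; rewrite gp => e /unit_neq_opp; rewrite e.
Qed.

(** [face_image], applied on the facet of [x] and on the opposite one, says that the
images of both ends of the [i]-th edge at [y] are known, and opposite, in
coordinate [edge_dir x i]; this edge has only one direction. *)
Lemma edge_dir_coord x y i : corner x -> corner y -> x i = y i ->
  edge_dir x i = edge_dir y i.
Proof.
move=> xc yc xy; apply/eqP/negPn/negP => dir.
set y' := flip [set i]%SET y; have y'c : corner y' by exact: corner_flip.
set x' := flip [set i]%SET x; have x'c : corner x' by exact: corner_flip.
have gy : g y (edge_dir x i) = g x (edge_dir x i).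
  by apply: face_image => //; exact: corner_ball.
have gy' : g y' (edge_dir x i) = g x' (edge_dir x i).
  rewrite -(edge_dir_flip1 i xc); apply: face_image => //; first exact: corner_ball.
  by rewrite /y' /x' /flip !inE eqxx xy.
move: gy'; rewrite !edge_dirP // /flip !inE eqxx (negbTE dir) gy => /eqP.
by rewrite unit_neq_opp //; exact: corner_image.
Qed.

(** Change the [i]-th coordinate of [x] into that of [y]: the direction for [i] is
then that of [y], and those for the other coordinates are those of [x]. As both
are injections of a finite set, they agree at [i] too. *)
Lemma edge_dir_const x y : corner x -> corner y -> edge_dir x =1 edge_dir y.
Proof.
move=> xc yc i; pose z : max_sum X := dfwith x i (y i).
have zi : z i = y i by rewrite /z dfwithin.
have zk k : i != k -> z k = x k by move=> ik; rewrite /z dfwithout.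
have zc : corner z.
  by move=> k; case: (eqVneq i k) => [<-|/zk ->]; rewrite ?zi.
rewrite -(edge_dir_coord zc yc zi).
have [t tK sK] := injF_bij (edge_dir_inj zc).
set k := t (edge_dir x i); have zkE : edge_dir z k = edge_dir x i by exact: sK.
case: (eqVneq i k) => [{2}->|ik]; first by rewrite zkE.
have : edge_dir x k = edge_dir x i by rewrite -zkE; apply/esym/edge_dir_coord/zk.
by move/(edge_dir_inj xc) => ki; rewrite ki eqxx in ik.
Qed.

Lemma noncontractive_ball_spheres x0 : corner x0 ->
  exists s : {perm I}, forall x p i, corner x -> unit_ball (max_sum X) p ->
    p i = x i -> g p (s i) = g x (s i).
Proof.
move=> x0c; exists (perm (edge_dir_inj x0c)) => x p i xc pB pxi.
by rewrite permE (edge_dir_const x0c xc); exact: face_image.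
Qed.

End Corners.

(** * Non-contractive maps of the ball and unit spheres *)

Theorem theorem4p2 (R : realType) (n : nat) (hn : (1 <= n)%N)
    (X : 'I_n -> completeNormedModType R)
    (hnontrivial : forall i, nontrivial (X i))
    (hconvex : forall i, strictly_convex (X i))
    (g : {fun unit_ball (max_sum X) >-> unit_ball (max_sum X)})
    (hg : noncontractive_on (unit_ball (max_sum X)) g) :
  exists (sigma : {perm 'I_n})
         (g_ : forall i, {fun unit_sphere (X i) >-> unit_sphere (X (sigma i))}),
    (forall i, noncontractive_on (unit_sphere (X i)) (g_ i)) /\
    (forall (x : max_sum X) (i : 'I_n), unit_ball (max_sum X) x ->
       unit_sphere (X i) (x i) -> g x (sigma i) = g_ i (x i)).
Proof.
have unit_vector i : exists v : X i, `|v| = 1.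
  have [v v0] : exists v : X i, v != 0.
    apply: contrapT => nov; apply: (hnontrivial i).
    apply/seteqP; split=> // v _; apply/eqP/negPn/negP => v0.
    by apply: nov; exists v.
  by exists (`|v|^-1 *: v); rewrite normrZ normfV normr_id mulVf ?normr_eq0.
pose x0 : max_sum X := fun i => sval (cid (unit_vector i)).
have x0c : corner x0 by move=> i; exact: (svalP (cid (unit_vector i))).
have gB x : unit_ball (max_sum X) x -> unit_ball (max_sum X) (g x) by exact: funS.
have [s gs] := noncontractive_ball_spheres hconvex gB hg x0c.
pose at_coord i (u : X i) : max_sum X := dfwith x0 i u.
have at_coord_i i u : at_coord i u i = u by rewrite /at_coord dfwithin.
have at_coord_corner i u : `|u| = 1 -> corner (at_coord i u).
  move=> u1 k; case: (eqVneq i k) => [<-|ik]; first by rewrite at_coord_i.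
  by rewrite /at_coord dfwithout.
have g_sphere i : {homo (fun u => g (at_coord i u) (s i)) :
    u / unit_sphere (X i) u >-> unit_sphere (X (s i)) u}.
  by move=> u u1; apply: (corner_image hconvex gB hg); exact: at_coord_corner.
exists s, (fun i => mkfun_fun (g_sphere i)).
split=> [i u v u1 v1 /=|x i xB x1 /=]; last first.
  by apply: gs => //; exact: at_coord_corner.
pose a := at_coord i u; pose b := at_coord i v.
have ac : corner a by exact: at_coord_corner.
have bc : corner b by exact: at_coord_corner.
have uv : `|u - v| <= `|g a - g b|.
  apply: le_trans (hg _ _ (corner_ball ac) (corner_ball bc)).
  rewrite -{1}[u](at_coord_i i) -{1}[v](at_coord_i i).
  exact: (norm_coord (a - b) i).
apply: le_trans uv _; apply: bigmax_le => // k _.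
(* Off coordinate [s i] the images agree, since [a] and [b] differ only at [i]. *)
rewrite [in X in `|X|](_ : (g a - g b) k = g a k - g b k) //.
have [t tK sK] := injF_bij (@perm_inj _ s).
rewrite -(sK k); case: (eqVneq i (t k)) => [<-//|ik].
have -> : g a (s (t k)) = g b (s (t k)).
  by apply: gs => //; [exact: corner_ball | rewrite /a /b /at_coord !dfwithout].
by rewrite subrr normr0.
Qed.
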